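(* An unbiased estimator of the risk $R_{b,\mu}=E(\ell_{b,\mu})$ is given by $$\hat R_{b,\mu}=\frac1{np}\sum_{i=1}^n\sum_{j=1}^p\Big[b_i^2(Y_{ij}-\mu_j)^2+(1-2b_i)\frac{V(Y_{ij})}{\tau_{ij}+\nu_2}\Big],$$ i.e. $E(\hat R_{b,\mu})=R_{b,\mu}$, where $$\ell_{b,\mu}=\frac1{np}\sum_{i=1}^n\sum_{j=1}^p(\hat\theta_{ij}^{b,\mu}-\theta_{ij})^2,\qquad \hat\theta_{ij}^{b,\mu}=(1-b_i)Y_{ij}+b_i\mu_j .$$
   Context: $\Theta\subseteq\mathbb R$ is the parameter space; $\nu_0,\nu_1,\nu_2\in\mathbb R$ are known constants and $V(t)=\nu_0+\nu_1t+\nu_2t^2$ satisfies $V(t)>0$ for all $t\in\Theta$. $Y_1,\dots,Y_n$ are mutually independent random vectors, $Y_i=(Y_{i1},\dots,Y_{ip})\in\mathbb R^p$, with finite mean and covariance matrix, $E(Y_{ij})=\theta_{ij}\in\Theta$ (unknown) and $\operatorname{Var}(Y_{ij})=V(\theta_{ij})/\tau_{ij}$, where $\tau_{ij}\in\mathbb N$ are known constants. The estimators $\hat\theta_{ij}^{b,\mu}$ shrink $Y_{ij}$ toward a given location $\mu_j$: here $b=(b_1,\dots,b_n)$ with $b_i\in[0,1]$, and $\mu=(\mu_1,\dots,\mu_p)\in\mathbb R^p$ is required to satisfy $|\mu_j|\le\max\{|Y_{il}|:i=1,\dots,n,\ l=1,\dots,p\}$ for all $j=1,\dots,p$. *)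

(* Defs.v *)
From HB Require Import structures.
From mathcomp Require Import all_boot all_order all_algebra.
From mathcomp Require Import all_classical all_reals all_analysis.

Set Implicit Arguments.
Unset Strict Implicit.
Unset Printing Implicit Defensive.

Import Order.TTheory GRing.Theory Num.Theory.

Local Open Scope classical_set_scope.
Local Open Scope ring_scope.

Definition mutually_independent (d d' : measure_display)
    (T : measurableType d) (T' : measurableType d') (R : realType)
    (P : probability T R) (I : finType) (X : I -> {RV P >-> T'}) : Prop :=
  forall (J : {set I}) (B : I -> set T'),
    (forall i, measurable (B i)) ->
    P (\bigcap_(i in [set` J]) (X i @^-1` B i)) =
    (\prod_(i in J) P (X i @^-1` B i))%E.

Definition rv_coord (d : measure_display) (T : measurableType d) (R : realType)
    (P : probability T R) (p : nat) (X : {RV P >-> p.-tuple R}) (j : 'I_p) :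
  T -> R := fun w => tnth (X w) j.

Definition finite_mean_covariance (d : measure_display) (T : measurableType d)
    (R : realType) (P : probability T R) (p : nat)
    (X : {RV P >-> p.-tuple R}) : Prop :=
  (forall j, P.-integrable setT (EFin \o rv_coord X j)) /\
  (forall j k, covariance P (rv_coord X j) (rv_coord X k) \is a fin_num).

Section quadratic_variance_shrinkage.
Context (R : realType) (n p : nat).

(* A realisation of the data is a family [y] of [n] vectors of length [p];
   the estimators below are functions of [y]. *)
Implicit Types (y : 'I_n -> p.-tuple R) (theta : 'I_n -> 'I_p -> R)
  (tau : 'I_n -> 'I_p -> nat) (b : 'I_n -> R) (mu : p.-tuple R).

Definition quad_var (nu0 nu1 nu2 t : R) : R := nu0 + nu1 * t + nu2 * t ^+ 2.

Definition shrink_est b mu y (i : 'I_n) (j : 'I_p) : R :=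
  (1 - b i) * tnth (y i) j + b i * tnth mu j.

Definition sq_loss theta b mu y : R :=
  (n * p)%:R^-1 *
  \sum_(i < n) \sum_(j < p) (shrink_est b mu y i j - theta i j) ^+ 2.

Definition risk_est (nu0 nu1 nu2 : R) tau b mu y : R :=
  (n * p)%:R^-1 *
  \sum_(i < n) \sum_(j < p)
    (b i ^+ 2 * (tnth (y i) j - tnth mu j) ^+ 2
     + (1 - 2 * b i) *
       (quad_var nu0 nu1 nu2 (tnth (y i) j) / ((tau i j)%:R + nu2))).

(* The default value 0 is neutral, the entries being nonnegative. *)
Definition max_abs y : R :=
  \big[Num.max/0]_(i < n) \big[Num.max/0]_(l < p) `|tnth (y i) l|.

Definition admissible_location y mu : Prop :=
  forall j : 'I_p, `|tnth mu j| <= max_abs y.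

End quadratic_variance_shrinkage.

Definition risk (d : measure_display) (T : measurableType d) (R : realType)
    (P : probability T R) (n p : nat) (Y : 'I_n -> {RV P >-> p.-tuple R})
    (theta : 'I_n -> 'I_p -> R) (b : 'I_n -> R) (mu : p.-tuple R) : \bar R :=
  ('E_P[fun w => sq_loss theta b mu (fun i => Y i w)])%E.

(* Main.v *)
Require Import Defs.
From HB Require Import structures.
From mathcomp Require Import all_boot all_order all_algebra.
From mathcomp Require Import all_classical all_reals all_analysis.
From mathcomp Require Import measurable_realfun ring.

(** The risk and its estimator are both averages over the [n * p] entries, and
    the expectation is linear, so it suffices to compare one entry at a time.
    Let [X] be an entry with mean [m] and variance [v = V(m) / tau].

    - As [X - m] has mean zero, the bias-variance expansion gives
      [E ((1 - b) X + b c - m)^2 = (1 - b)^2 v + b^2 (c - m)^2].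
    - The unknown [v] has an unbiased estimator because [V] is quadratic: by a
      second-order Taylor expansion at [m],
      [E V(X) = V(m) + nu2 v = (tau + nu2) v], so [V(X) / (tau + nu2)] has
      mean [v].
    - Since [E (X - c)^2 = v + (m - c)^2], the summand of the risk estimator
      has mean [b^2 (v + (m - c)^2) + (1 - 2 b) v], which is the value found
      above because [b^2 + (1 - 2 b) = (1 - b)^2].

    Linearity of the expectation requires integrability of each term, so the
    predicate [has_mean] carries it along with the value of the expectation.
    For the quadratic terms it comes from the finiteness of the variance. *)

Set Implicit Arguments.
Unset Strict Implicit.
Unset Printing Implicit Defensive.

Import Order.TTheory GRing.Theory Num.Theory.

Local Open Scope classical_set_scope.
Local Open Scope ring_scope.

(** Pairing the integrability of [f] with the value of its expectation makes
    the predicate stable under linear combinations, which the value of the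
    expectation alone is not. *)
Definition has_mean (d : measure_display) (T : measurableType d)
    (R : realType) (P : probability T R) (f : T -> R) (m : R) : Prop :=
  P.-integrable setT (EFin \o f) /\ ('E_P[f] = m%:E)%E.

Section means.
Context (d : measure_display) (T : measurableType d) (R : realType)
  (P : probability T R).
Implicit Types (f g X : T -> R) (a b c m v : R).

Lemma has_mean_cst a : has_mean P (fun=> a) a.
Proof.
split; last exact: expectation_cst.
exact: (finite_measure_integrable_cst P).
Qed.

Lemma has_meanD f g a b : has_mean P f a -> has_mean P g b ->
  has_mean P (fun w => f w + g w) (a + b).
Proof.
move=> [fi fE] [gi gE]; split; first exact: (integrableD measurableT fi gi).
by rewrite EFinD -fE -gE unlock -(integralD measurableT fi gi).
Qed.

Lemma has_meanZ f a c : has_mean P f a -> has_mean P (fun w => c * f w) (c * a).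
Proof.
move=> [fi fE]; split; first exact: (integrableZl measurableT c fi).
by rewrite EFinM -fE unlock -(integralZl measurableT fi c).
Qed.

Lemma has_mean_sum (I : finType) (F : I -> T -> R) (a : I -> R) :
  (forall i, has_mean P (F i) (a i)) ->
  has_mean P (fun w => \sum_i F i w) (\sum_i a i).
Proof.
move=> FP; elim: (index_enum I) => [|i s IH].
  under eq_fun do rewrite big_nil; rewrite big_nil.
  exact: has_mean_cst.
under eq_fun do rewrite big_cons; rewrite big_cons.
exact: has_meanD (FP i) IH.
Qed.

(** The variance is an expectation that is defined whether or not [X] has a
    second moment. Its finiteness gives integrability of the squared deviation
    because the latter is nonnegative. *)
Lemma has_mean_sqdev X m v : measurable_fun setT X ->
  ('E_P[X] = m%:E)%E -> ('V_P[X] = v%:E)%E ->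
  has_mean P (fun w => (X w - m) ^+ 2) v.
Proof.
move=> mX EX; rewrite /variance unlock EX /= => VX.
have E2 : ('E_P[fun w => ((X w - m) ^+ 2)%R] = v%:E)%E.
  by rewrite -VX; congr (expectation P _); apply/funext => w; rewrite expr2.
split=> //; apply/integrableP; split.
  apply/measurable_EFinP; apply: measurable_funX.
  exact: measurable_funB mX (measurable_cst m).
under eq_integral => w _ do rewrite /= ger0_norm ?sqr_ge0//.
by move: E2; rewrite unlock => ->; exact: ltry.
Qed.

End means.

Section entry.
Context (d : measure_display) (T : measurableType d) (R : realType)
  (P : probability T R) (X : T -> R) (m v : R)
  (meanX : has_mean P X m)
  (varX : has_mean P (fun w => (X w - m) ^+ 2) v).

(** The first-order term of the Taylor expansion at the mean vanishes in
    expectation. Every quadratic function of an entry below is handled by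
    giving its expansion at [m]. *)
Lemma has_mean_taylor2 (f : R -> R) (a0 a1 a2 : R) :
  (forall x, f x = a0 + a1 * (x - m) + a2 * (x - m) ^+ 2) ->
  has_mean P (fun w => f (X w)) (a0 + a2 * v).
Proof.
move=> fE; under eq_fun do rewrite fE.
apply: has_meanD; last exact: has_meanZ.
have := has_meanZ a1 (has_meanD meanX (has_mean_cst P (- m))).
by move/(has_meanD (has_mean_cst P a0)); rewrite subrr mulr0 addr0.
Qed.

Lemma has_mean_quad_var nu0 nu1 nu2 :
  has_mean P (fun w => quad_var nu0 nu1 nu2 (X w))
    (quad_var nu0 nu1 nu2 m + nu2 * v).
Proof.
apply: (@has_mean_taylor2 _ _ (nu1 + 2 * nu2 * m)) => x.
by rewrite /quad_var; ring.
Qed.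

Lemma has_mean_sqr_sub c :
  has_mean P (fun w => (X w - c) ^+ 2) ((m - c) ^+ 2 + v).
Proof.
rewrite -[v]mul1r.
by apply: (@has_mean_taylor2 (fun x => (x - c) ^+ 2) _ (2 * (m - c))) => x; ring.
Qed.

(** The error [(1 - b) X + b c - m] is [(1 - b) (X - m) + b (c - m)]: the
    shrunken deviation of [X], which yields the variance term, plus a
    constant bias. *)
Lemma has_mean_shrink_loss b c :
  has_mean P (fun w => ((1 - b) * X w + b * c - m) ^+ 2)
    (b ^+ 2 * (m - c) ^+ 2 + (1 - b) ^+ 2 * v).
Proof.
apply: (@has_mean_taylor2 (fun x => ((1 - b) * x + b * c - m) ^+ 2) _
  (2 * (1 - b) * b * (c - m))) => x.
by ring.
Qed.

(** Here the quadratic shape of the variance function is used: with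
    [v = V(m) / tau], the mean [V(m) + nu2 v] of [V(X)] is the known multiple
    [tau + nu2] of the unknown [v]. *)
Lemma has_mean_quad_var_div nu0 nu1 nu2 tau :
  tau != 0 -> tau + nu2 != 0 -> v = quad_var nu0 nu1 nu2 m / tau ->
  has_mean P (fun w => quad_var nu0 nu1 nu2 (X w) / (tau + nu2)) v.
Proof.
move=> tau0 tnu0 vE.
have /(has_meanZ (tau + nu2)^-1) := has_mean_quad_var nu0 nu1 nu2.
have -> : quad_var nu0 nu1 nu2 m = tau * v by rewrite vE mulrC divfK.
rewrite -mulrDl mulKf//.
by under eq_fun do rewrite mulrC.
Qed.

Lemma has_mean_risk_est_entry nu0 nu1 nu2 tau b c :
  tau != 0 -> tau + nu2 != 0 -> v = quad_var nu0 nu1 nu2 m / tau ->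
  has_mean P (fun w => b ^+ 2 * (X w - c) ^+ 2
      + (1 - 2 * b) * (quad_var nu0 nu1 nu2 (X w) / (tau + nu2)))
    (b ^+ 2 * (m - c) ^+ 2 + (1 - b) ^+ 2 * v).
Proof.
move=> tau0 tnu0 vE.
have -> : b ^+ 2 * (m - c) ^+ 2 + (1 - b) ^+ 2 * v =
    b ^+ 2 * ((m - c) ^+ 2 + v) + (1 - 2 * b) * v by ring.
apply: has_meanD; apply: has_meanZ; first exact: has_mean_sqr_sub.
exact: has_mean_quad_var_div.
Qed.

End entry.

Lemma measurable_rv_coord (d : measure_display) (T : measurableType d)
    (R : realType) (P : probability T R) (p : nat) (X : {RV P >-> p.-tuple R})
    (j : 'I_p) : measurable_fun setT (rv_coord X j).
Proof. exact: (measurableT_comp (measurable_tnth j)). Qed.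

(* [mu] is deterministic, and the data-dependent bound on it is only asked at
   one realisation [w0] of the data (the observed one); this is implied by
   asking it surely or almost surely. *)
Theorem proposition3p1 (d : measure_display) (T : measurableType d)
    (R : realType) (P : probability T R) (n p : nat)
    (n_gt0 : (0 < n)%N) (p_gt0 : (0 < p)%N)
    (Theta : set R) (nu0 nu1 nu2 : R)
    (V_gt0 : forall t, Theta t -> 0 < quad_var nu0 nu1 nu2 t)
    (theta : 'I_n -> 'I_p -> R) (theta_in : forall i j, Theta (theta i j))
    (tau : 'I_n -> 'I_p -> nat) (tau_gt0 : forall i j, (0 < tau i j)%N)
    (tau_nu2 : forall i j, (tau i j)%:R + nu2 != 0)
    (Y : 'I_n -> {RV P >-> p.-tuple R})
    (Y_indep : mutually_independent Y)
    (Y_fin : forall i, finite_mean_covariance (Y i))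
    (Y_mean : forall i j, ('E_P[rv_coord (Y i) j] = (theta i j)%:E)%E)
    (Y_var : forall i j, ('V_P[rv_coord (Y i) j] =
       (quad_var nu0 nu1 nu2 (theta i j) / (tau i j)%:R)%:E)%E)
    (b : 'I_n -> R) (b01 : forall i, 0 <= b i <= 1)
    (mu : p.-tuple R) (w0 : T)
    (mu_adm : admissible_location (fun i => Y i w0) mu) :
  ('E_P[fun w => risk_est nu0 nu1 nu2 tau b mu (fun i => Y i w)] =
   risk Y theta b mu)%E.

Proof.
pose v i j := quad_var nu0 nu1 nu2 (theta i j) / (tau i j)%:R.
(* The common mean of the summands of the loss and of the estimator. *)
pose r i j := b i ^+ 2 * (theta i j - tnth mu j) ^+ 2 + (1 - b i) ^+ 2 * v i j.
have meanY i j : has_mean P (rv_coord (Y i) j) (theta i j).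
  by split; [exact: (Y_fin i).1 | exact: Y_mean].
have varY i j : has_mean P (fun w => (rv_coord (Y i) j w - theta i j) ^+ 2)
    (v i j).
  apply: has_mean_sqdev; [exact: measurable_rv_coord|exact: Y_mean|].
  exact: Y_var.
have [_ ->] : has_mean P
    (fun w => risk_est nu0 nu1 nu2 tau b mu (fun i => Y i w))
    ((n * p)%:R^-1 * \sum_(i < n) \sum_(j < p) r i j).
  apply: has_meanZ; do 2 (apply: has_mean_sum => ?).
  by apply: (has_mean_risk_est_entry (meanY _ _) (varY _ _)) => //;
    rewrite pnatr_eq0 -lt0n.
suff [_ <-] : has_mean P (fun w => sq_loss theta b mu (fun i => Y i w))
    ((n * p)%:R^-1 * \sum_(i < n) \sum_(j < p) r i j) by [].
apply: has_meanZ; do 2 (apply: has_mean_sum => ?).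
exact: has_mean_shrink_loss (meanY _ _) (varY _ _) _ _.
Qed.
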